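(* Assume $\widehat A_h\in\mathbb{R}^{M_h\times n_h}$, $M_h\ge n_h$, has full column rank. Let $\widetilde q_{i,h}\in\mathbb{R}^{n_h}$ approximate the exact adjoint solution $q_{i,h}$, and define $\widetilde g_{i,h}:=W_h\widehat A_h\widetilde q_{i,h}$, $s_{i,h}:=\widehat\ell_{i,h}-\widehat H_h\widetilde q_{i,h}$. Assume that $$\delta_{i,h}^{\mathrm{adj}}\ge\left(s_{i,h}^\top\widehat H_h^{-1}s_{i,h}\right)^{1/2}.$$ Define $\widetilde\sigma_{i,h}^+:=\|\widetilde g_{i,h}\|_{W_h^{-1}}+\delta_{i,h}^{\mathrm{adj}}$ and $\widetilde c_{i,h}^{\mathrm{corr}}:=\ell_{i,h}^\top U_\theta-\widetilde g_{i,h}^\top r_h$. Then $$\|g_{i,h}-\widetilde g_{i,h}\|_{W_h^{-1}}\le\delta_{i,h}^{\mathrm{adj}},\qquad \sigma_{i,h}\le\widetilde\sigma_{i,h}^+,$$ and, whenever $U_h^\pi=U_{0,h}+Z_hy_h^\pi$ is an admissible comparison vector with $T_h\ge\|A_hU_h^\pi-b_h\|_{W_h}$ and $\varepsilon_{i,h}^{\mathrm{eval}}\ge|\ell_{i,h}^\top U_h^\pi-u^\star(x_i)|$, $$u^\star(x_i)\in\left[\widetilde c_{i,h}^{\mathrm{corr}}-\delta_{i,h}^{\mathrm{adj}}\|r_h\|_{W_h}-\widetilde\sigma_{i,h}^+T_h-\varepsilon_{i,h}^{\mathrm{eval}},\;\widetilde c_{i,h}^{\mathrm{corr}}+\delt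a_{i,h}^{\mathrm{adj}}\|r_h\|_{W_h}+\widetilde\sigma_{i,h}^+T_h+\varepsilon_{i,h}^{\mathrm{eval}}\right].$$
   Context: $u^\star$ is the exact solution (unique in its admissible class) of a boundary-value problem on a bounded domain, with $u^\star(x_i)$ well defined at the query point $x_i$. Let $U_{0,h}\in\mathbb{R}^{N_h}$ and let $Z_h\in\mathbb{R}^{N_h\times n_h}$ have full column rank. Let $A_h\in\mathbb{R}^{M_h\times N_h}$, $b_h\in\mathbb{R}^{M_h}$, $\widehat A_h:=A_hZ_h$. Let $W_h\in\mathbb{R}^{M_h\times M_h}$ be symmetric positive definite, $\|r\|_{W_h}:=(r^\top W_hr)^{1/2}$, $\|g\|_{W_h^{-1}}:=(g^\top W_h^{-1}g)^{1/2}$, $\widehat H_h:=\widehat A_h^\top W_h\widehat A_h$. $U_\theta=U_{0,h}+Z_hy_\theta$ is an arbitrary admissible vector with residual $r_h:=A_hU_\theta-b_h$. For the query vector $\ell_{i,h}\in\mathbb{R}^{N_h}$, $\widehat\ell_{i,h}:=Z_h^\top\ell_{i,h}$, $q_{i,h}$ solves $\widehat H_hq_{i,h}=\widehat\ell_{i,h}$, $g_{i,h}:=W_h\widehat A_hq_{i,h}$, $\sigma_{i,h}:=\|g_{i,h}\|_{W_h^{-1}}$. *)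

(* Defs.v *)
From HB Require Import structures.
From mathcomp Require Import all_boot all_order all_algebra.
From mathcomp Require Import all_classical all_reals all_analysis.

Set Implicit Arguments.
Unset Strict Implicit.
Unset Printing Implicit Defensive.

Import Order.TTheory GRing.Theory Num.Theory.
Import numFieldNormedType.Exports.

Local Open Scope classical_set_scope.
Local Open Scope ring_scope.

(* A scalar boundary-value problem on a subset of R^(d+1): find u in the
   admissible class with [pde_op u = pde_rhs] and [bc_op u = bc_rhs].
   The residual spaces are arbitrary types, so that the equations may be
   pointwise, variational, or systems.  Candidates are total functions, whose
   values outside the closure of the domain are irrelevant; when solutions are
   classes modulo null sets, the class consists of chosen representatives. *)
Record bvp (R : realType) (d : nat) := BVP {
  bvp_domain : set 'rV[R]_d.+1;
  bvp_class : set ('rV[R]_d.+1 -> R);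
  pde_space : Type;
  pde_op : ('rV[R]_d.+1 -> R) -> pde_space;
  pde_rhs : pde_space;
  bc_space : Type;
  bc_op : ('rV[R]_d.+1 -> R) -> bc_space;
  bc_rhs : bc_space
}.

Definition bounded_domain (R : realType) (d : nat) (O : set 'rV[R]_d.+1) :=
  [/\ open O, connected O, O !=set0 & bounded_set O].

Definition bvp_solution (R : realType) (d : nat) (P : bvp R d)
    (u : 'rV[R]_d.+1 -> R) :=
  [/\ bvp_class P u, pde_op P u = pde_rhs P & bc_op P u = bc_rhs P].

Definition bvp_unique_solution (R : realType) (d : nat) (P : bvp R d)
    (u : 'rV[R]_d.+1 -> R) :=
  bvp_solution P u /\
  forall v, bvp_solution P v ->
    forall x, closure (bvp_domain P) x -> v x = u x.

Definition sym_posdef (R : realType) (m : nat) (W : 'M[R]_m) :=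
  W^T = W /\ forall x : 'cV[R]_m, x != 0 -> 0 < (x^T *m W *m x) 0 0.

Definition wnorm (R : realType) (m : nat) (W : 'M[R]_m) (r : 'cV[R]_m) : R :=
  Num.sqrt ((r^T *m W *m r) 0 0).

Definition cdot (R : realType) (m : nat) (v w : 'cV[R]_m) : R :=
  (v^T *m w) 0 0.

(* Main.v *)
Require Import Defs.
From HB Require Import structures.
From mathcomp Require Import all_boot all_order all_algebra.
From mathcomp Require Import all_classical all_reals all_analysis.
From mathcomp Require Import ring lra.
Import Order.TTheory GRing.Theory Num.Theory.
Import numFieldNormedType.Exports.
Local Open Scope classical_set_scope.
Local Open Scope ring_scope.

(* With [v = Ahat q], [vt = Ahat qt] one has [g = W v] and [gt = W vt], so every
   dual quantity becomes a primal one: [wnorm (invmx W) (W v) = wnorm W v] and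
   [cdot (W v) r] is the W-inner product of [v] and [r].  The vector
   [s = Hhat (q - qt)] has dual energy equal to the squared W-norm of [v - vt].
   As [ell] restricted to the range of [Z] is represented by [g],
     cdot ell Upi = ccorr - cdot (g - gt) r + cdot g (A Upi - b),
   and Cauchy-Schwarz bounds the last two terms. *)

Definition wdot {R : realType} {m : nat} (W : 'M[R]_m) (v w : 'cV[R]_m) : R :=
  (v^T *m W *m w) 0 0.

Section WeightedInnerProduct.
Context {R : realType} {m : nat} {W : 'M[R]_m}.
Hypothesis hW : sym_posdef W.
Implicit Types u v w : 'cV[R]_m.

Lemma wdotC v w : wdot W v w = wdot W w v.
Proof.
have [WT _] := hW.
have trE (B : 'M[R]_1) : B 0 0 = B^T 0 0 by rewrite mxE.
by rewrite /wdot trE !trmx_mul WT trmxK mulmxA.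
Qed.

Lemma wdotDr u v w : wdot W u (v + w) = wdot W u v + wdot W u w.
Proof. by rewrite /wdot mulmxDr mxE. Qed.

Lemma wdotDl u v w : wdot W (v + w) u = wdot W v u + wdot W w u.
Proof. by rewrite !(wdotC _ u) wdotDr. Qed.

Lemma wdotZr (c : R) v w : wdot W v (c *: w) = c * wdot W v w.
Proof. by rewrite /wdot -scalemxAr mxE. Qed.

Lemma wdotZl (c : R) v w : wdot W (c *: v) w = c * wdot W v w.
Proof. by rewrite wdotC wdotZr wdotC. Qed.

Lemma wdot_ge0 v : 0 <= wdot W v v.
Proof.
have [_ W0] := hW; have [->|v0] := eqVneq v 0; last exact/ltW/W0.
by rewrite /wdot mulmx0 mxE.
Qed.

Lemma wdot_eq0 v : wdot W v v = 0 -> v = 0.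
Proof.
have [_ W0] := hW; have [//|v0] := eqVneq v 0.
by move: (W0 _ v0); rewrite -/(wdot W v v) => /[swap] ->; rewrite ltxx.
Qed.

Lemma sqr_wnorm v : wnorm W v ^+ 2 = wdot W v v.
Proof. by rewrite sqr_sqrtr ?wdot_ge0. Qed.

Lemma wnorm_ge0 v : 0 <= wnorm W v.
Proof. exact: sqrtr_ge0. Qed.

Lemma wdot_cauchy_schwarz v w : `|wdot W v w| <= wnorm W v * wnorm W w.
Proof.
have [->|w0] := eqVneq w 0.
  by rewrite /wdot mulmx0 mxE normr0 mulr_ge0 ?wnorm_ge0.
have c0 : 0 < wdot W w w.
  by rewrite lt_def wdot_ge0 andbT; apply: contra_neq w0; exact: wdot_eq0.
rewrite -ler_sqr ?nnegrE ?mulr_ge0 ?wnorm_ge0 //.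
rewrite real_normK ?num_real // exprMn !sqr_wnorm.
(* This vector is [wdot W w w] times the component of [v] orthogonal to [w], scaled to avoid
   division. Its energy is [c * (a * c - B ^+ 2)], and the factor [c > 0] cancels. *)
have := wdot_ge0 (wdot W w w *: v - wdot W v w *: w).
rewrite -scaleNr !(wdotDl, wdotDr, wdotZl, wdotZr) (wdotC w v).
set a := wdot W v v; set c := wdot W w w; set B := wdot W v w => h.
rewrite -subr_ge0 -(pmulr_rge0 _ c0) -/c.
by apply: le_trans h _; rewrite le_eqVlt; apply/orP; left; apply/eqP; ring.
Qed.

Lemma ler_wnormD v w : wnorm W (v + w) <= wnorm W v + wnorm W w.
Proof.
rewrite -ler_sqr ?nnegrE ?addr_ge0 ?wnorm_ge0 // sqrrD !sqr_wnorm.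
rewrite !(wdotDl, wdotDr) (wdotC w v).
have := le_trans (ler_norm _) (wdot_cauchy_schwarz v w).
lra.
Qed.

(** A row [v] killed by the Gram matrix gives [A *m v^T] zero energy, hence [A *m v^T = 0] by
    definiteness, and full column rank forces [v = 0]. *)
Lemma gram_unitmx n (A : 'M[R]_(m, n)) :
  \rank A = n -> A^T *m W *m A \in unitmx.
Proof.
move=> rA; rewrite -row_free_unit; apply: inj_row_free => v vH.
have Av0 : A *m v^T = 0.
  apply: wdot_eq0; rewrite /wdot trmx_mul trmxK.
  by rewrite !mulmxA -2!(mulmxA v) vH mul0mx mxE.
have fA : row_free A^T by rewrite /row_free mxrank_tr rA.
apply: (row_free_inj fA); rewrite mul0mx.
by apply: trmx_inj; rewrite trmx_mul trmxK Av0 trmx0.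
Qed.

(** [W] is its own Gram matrix for the identity. *)
Lemma sym_posdef_unitmx : W \in unitmx.
Proof. by have := gram_unitmx _ 1%:M (mxrank1 _ _); rewrite trmx1 mul1mx mulmx1. Qed.

Lemma wnorm_dual v : wnorm (invmx W) (W *m v) = wnorm W v.
Proof.
have [WT _] := hW.
by rewrite /wnorm trmx_mul WT -!mulmxA mulKmx ?sym_posdef_unitmx.
Qed.

Lemma cdot_dual v w : cdot (W *m v) w = wdot W v w.
Proof. by have [WT _] := hW; rewrite /cdot trmx_mul WT. Qed.

(** The inverse cancels one factor [H], and the outer [A^T] of the other moves across the product.
    With [e = q - qt] this turns the computable adjoint residual into the error of the dual
    vector. *)
Lemma gram_dual_energy n (A : 'M[R]_(m, n)) (e : 'cV[R]_n) :
  let H := A^T *m W *m A in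
  \rank A = n ->
  ((H *m e)^T *m invmx H *m (H *m e)) 0 0 = wdot W (A *m e) (A *m e).
Proof.
move=> H rA; have uH : H \in unitmx by exact: gram_unitmx.
rewrite -(mulmxA (H *m e)^T) mulKmx // -cdot_dual /cdot.
have -> : H *m e = A^T *m (W *m (A *m e)) by rewrite !mulmxA.
by rewrite trmx_mul trmxK -mulmxA.
Qed.

End WeightedInnerProduct.

Lemma cdotBr {R : realType} {m : nat} (u v w : 'cV[R]_m) :
  cdot u (v - w) = cdot u v - cdot u w.
Proof. by rewrite /cdot mulmxBr !mxE. Qed.

Lemma cdotBl {R : realType} {m : nat} (u v w : 'cV[R]_m) :
  cdot (v - w) u = cdot v u - cdot w u.
Proof. by rewrite /cdot linearB /= mulmxBl !mxE. Qed.

Theorem propositionB11 (R : realType) (d : nat) (P : bvp R d)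
    (ustar : 'rV[R]_d.+1 -> R) (xi : 'rV[R]_d.+1)
    (hO : bounded_domain (bvp_domain P))
    (hustar : bvp_unique_solution P ustar)
    (hxi : closure (bvp_domain P) xi)
    (M N n : nat) (U0 : 'cV[R]_N) (Z : 'M[R]_(N, n)) (hZ : \rank Z = n)
    (A : 'M[R]_(M, N)) (b : 'cV[R]_M)
    (W : 'M[R]_M) (hW : sym_posdef W)
    (ytheta : 'cV[R]_n) (ell : 'cV[R]_N) (q qt : 'cV[R]_n) (delta : R) :
  let Ahat := A *m Z in
  let Hhat := Ahat^T *m W *m Ahat in
  let Utheta := U0 + Z *m ytheta in
  let r := A *m Utheta - b in
  let ellhat := Z^T *m ell in
  let g := W *m Ahat *m q in
  let sigma := wnorm (invmx W) g in
  let gt := W *m Ahat *m qt in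
  let s := ellhat - Hhat *m qt in
  let sigmap := wnorm (invmx W) gt + delta in
  let ccorr := cdot ell Utheta - cdot gt r in
  (n <= M)%N ->
  \rank Ahat = n ->
  Hhat *m q = ellhat ->
  Num.sqrt ((s^T *m invmx Hhat *m s) 0 0) <= delta ->
  [/\ wnorm (invmx W) (g - gt) <= delta,
      sigma <= sigmap
    & forall (ypi : 'cV[R]_n) (T eps : R),
        let Upi := U0 + Z *m ypi in
        wnorm W (A *m Upi - b) <= T ->
        `|cdot ell Upi - ustar xi| <= eps ->
        ustar xi \in
          `[ccorr - delta * wnorm W r - sigmap * T - eps,
            ccorr + delta * wnorm W r + sigmap * T + eps]%R].
Proof.
move=> Ahat Hhat Utheta r ellhat g sigma gt s sigmap ccorr _ rA Hq hdelta.
have gE : g = W *m (Ahat *m q) by rewrite mulmxA.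
have gtE : gt = W *m (Ahat *m qt) by rewrite mulmxA.
have dgE : g - gt = W *m (Ahat *m (q - qt)) by rewrite gE gtE -!mulmxBr.
have dg : wnorm (invmx W) (g - gt) <= delta.
  rewrite dgE wnorm_dual //; apply: le_trans hdelta.
  by rewrite /s -Hq -mulmxBr gram_dual_energy.
have sig : sigma <= sigmap.
  (* Triangle inequality for [g = gt + (g - gt)], carried out on the primal side, where
     [sym_posdef W] is available directly. *)
  rewrite /sigma /sigmap; apply: le_trans (lerD (lexx _) dg).
  rewrite dgE gE gtE !wnorm_dual // mulmxBr.
  by apply: le_trans (ler_wnormD hW _ _); rewrite addrC subrK.
split=> // ypi T eps Upi hT heps.
set rpi := A *m Upi - b.
(* [U0] and [b] cancel in the differences, which are images of [ypi - ytheta] under [Z] and [Ahat].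
   The adjoint equation then reads [ellhat = Ahat^T *m g]. *)
have repr : cdot ell Upi - cdot ell Utheta = cdot g (rpi - r).
  rewrite -cdotBr.
  have -> : Upi - Utheta = Z *m (ypi - ytheta).
    by rewrite /Upi /Utheta mulmxBr opprD addrACA subrr add0r.
  have -> : rpi - r = Ahat *m (ypi - ytheta).
    rewrite /rpi /r /Upi /Utheta /Ahat opprB addrA subrK -mulmxBr opprD.
    by rewrite addrACA subrr add0r -mulmxBr mulmxA.
  have -> : cdot ell (Z *m (ypi - ytheta)) = cdot ellhat (ypi - ytheta).
    by rewrite /cdot /ellhat trmx_mul trmxK mulmxA.
  have -> : ellhat = Ahat^T *m g by rewrite -Hq gE /Hhat -!mulmxA.
  by rewrite /cdot (trmx_mul Ahat^T) trmxK mulmxA.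
have defect : `|cdot (g - gt) r| <= delta * wnorm W r.
  rewrite dgE cdot_dual //; apply: le_trans (wdot_cauchy_schwarz hW _ _) _.
  by rewrite ler_wpM2r ?wnorm_ge0 // -(wnorm_dual hW) -dgE.
(* The exact [sigma] arises from Cauchy-Schwarz and is then replaced by its upper bound [sigmap]. *)
have comparison : `|cdot g rpi| <= sigmap * T.
  rewrite gE cdot_dual //; apply: le_trans (wdot_cauchy_schwarz hW _ _) _.
  by rewrite ler_pM ?wnorm_ge0 // -(wnorm_dual hW) -gE.
(* Once the pairings are split, [cdot g r] cancels between [repr] and [defect]. What remains is
   linear, with [delta * wnorm W r] and [sigmap * T] as atoms. *)
move: repr heps defect comparison; rewrite in_itv /= /ccorr cdotBr cdotBl.
rewrite !ler_norml.
by move=> repr /andP[? ?] /andP[? ?] /andP[? ?]; apply/andP; split; lra.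
Qed.
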